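(* Let $n\ge 2$ be an integer. Suppose $A\subseteq\mathbb{F}_{2^{n-1}}\setminus\{0\}$ and $B\subseteq\mathbb{F}_{2^n}\setminus\mathbb{F}_{2^{n-1}}$. Then $r(A\cup B)=r(A)+3\,r(A,B,B)$.
   Context: For subsets $X,Y,Z$ of a finite additive abelian group, $r(X,Y,Z)$ denotes the number of ordered pairs $(x,y)\in X\times Y$ with $x+y\in Z$; and $r(X)=r(X,X,X)$. Only the additive group of $\mathbb{F}_{2^n}$ is used: its elements are written as vectors $[\alpha_1,\dots,\alpha_n]$ with $\alpha_i\in\{0,1\}$ and addition coordinatewise modulo 2. By convention $\mathbb{F}_{2^{n-1}}$ is regarded as the subset of $\mathbb{F}_{2^n}$ consisting of the vectors with first coordinate $\alpha_1=0$ (prefix each vector of length $n-1$ with $0$). *)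

(* Defs.v *)
From HB Require Import structures.
From mathcomp Require Import all_boot all_order all_algebra.

Set Implicit Arguments.
Unset Strict Implicit.
Unset Printing Implicit Defensive.

Import GRing.Theory.
Local Open Scope ring_scope.

Definition rcount (G : finZmodType) (X Y Z : {set G}) : nat :=
  #|[set p : G * G | [&& p.1 \in X, p.2 \in Y & p.1 + p.2 \in Z]]|.

Definition rcount1 (G : finZmodType) (X : {set G}) : nat := rcount X X X.

(* Only the additive group of the field with 2^n elements matters here, so it
   is given by its coordinate vectors over 'F_2. *)
Definition F2vec (n : nat) : finZmodType := 'rV['F_2]_n.

(* The copy of F2vec n.-1 inside F2vec n: vectors whose first coordinate
   (index 0 in 'I_n) vanishes. The quantification over i avoids requiring 'I_n
   to be syntactically nonempty; for 0 < n exactly one i satisfies i = 0. *)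
Definition F2sub (n : nat) : {set F2vec n} :=
  [set v : 'rV['F_2]_n | [forall i : 'I_n, (val i == 0%N) ==> (v ord0 i == 0)]].

Lemma F2subS (m : nat) :
  F2sub m.+1 = [set (row_mx 0 w : 'rV['F_2]_(1 + m)) | w : 'rV['F_2]_m].
Proof.
apply/setP => v; rewrite inE; apply/forallP/imsetP => [v0 | [w _ ->] i].
  exists (rsubmx (v : 'rV_(1 + m))) => //.
  have l0 : lsubmx (v : 'rV_(1 + m)) = 0.
    apply/rowP => j; rewrite !mxE (ord1 j).
    by have /eqP := v0 (lshift m (ord0 : 'I_1)).
  by rewrite -l0 (@hsubmxK _ 1 1 m).
apply/implyP => /eqP i0; have -> : i = lshift m (ord0 : 'I_1) by apply: val_inj.
by rewrite (@row_mxEl _ 1 1 m) mxE.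
Qed.

(* Main.v *)
Require Import Defs.
From HB Require Import structures.
From mathcomp Require Import all_boot all_order all_algebra.

(** The subspace [H] of vectors with vanishing first coordinate has index 2, so
    among [x], [y] and [x + y] the number of vectors outside [H] is 0 or 2.
    Since [A] lies inside [H] and [B] outside, a pair counted by [r(A :|: B)]
    has all three of [x], [y], [x + y] in [A], or exactly one of them in [A] and
    the other two in [B] ([rcount1U_index2]). As the group has exponent 2, the
    equation [x + y = z] is symmetric in its three unknowns, so the position of
    the element of [A] does not affect the count ([rcountC], [rcount_rev]), and
    each of the three mixed cases contributes [r(A, B, B)]. *)

Import GRing.Theory.
Local Open Scope ring_scope.

Lemma rcountE (G : finZmodType) (X Y Z : {set G}) :
  rcount X Y Z =
    (\sum_(p : G * G) [&& p.1 \in X, p.2 \in Y & (p.1 + p.2)%R \in Z])%N.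
Proof.
rewrite /rcount -sum1_card big_mkcond /=; apply: eq_bigr => p _.
by rewrite inE; case: ifP.
Qed.

Lemma rcountC (G : finZmodType) (X Y Z : {set G}) :
  rcount X Y Z = rcount Y X Z.
Proof.
have swapK : involutive (fun p : G * G => (p.2, p.1)) by case.
rewrite !rcountE (reindex_inj (inv_inj swapK)) /=; apply: eq_bigr => p _.
by rewrite andbCA addrC.
Qed.

(** In exponent 2, [(x, y) |-> (x + y, y)] is an involution on pairs, and it
    exchanges the first summand with the sum. *)
Lemma rcount_rev (G : finZmodType) (addxx : forall x : G, x + x = 0)
    (X Y Z : {set G}) :
  rcount X Y Z = rcount Z Y X.
Proof.
have shearK : involutive (fun p : G * G => (p.1 + p.2, p.2)).
  by case=> x y /=; rewrite -addrA addxx addr0.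
rewrite !rcountE (reindex_inj (inv_inj shearK)) /=; apply: eq_bigr => p _.
by rewrite -addrA addxx addr0 andbA andbC (andbC (_ \in X)).
Qed.

(** Of the eight ways to place [x], [y] and [x + y] in [A] or [B], [H_add]
    leaves only those with an even number of elements in [B]. *)
Lemma rcount1U_index2 (G : finZmodType) (H A B : {set G})
    (H_add : forall x y : G, (x + y \in H) = ((x \in H) == (y \in H)))
    (sAH : A \subset H) (sBH : B \subset ~: H) :
  rcount1 (A :|: B) =
    (rcount1 A + rcount A B B + rcount B A B + rcount B B A)%N.
Proof.
have memA z : (z \in A) ==> (z \in H) by apply/implyP/(subsetP sAH).
have memB z : (z \in B) ==> (z \notin H).
  by apply/implyP => /(subsetP sBH); rewrite inE.
rewrite /rcount1 !rcountE -!big_split /=; apply: eq_bigr => -[x y] _ /=.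
rewrite !inE; move: (H_add x y) (memA x) (memB x) (memA y) (memB y).
move: (memA (x + y)) (memB (x + y)).
(* What remains is a tautology in the nine membership booleans. *)
by case: (x + y \in A); case: (x + y \in B); case: (x + y \in H);
   case: (x \in A); case: (x \in B); case: (x \in H);
   case: (y \in A); case: (y \in B); case: (y \in H).
Qed.

Lemma addF2vv (n : nat) (v : F2vec n) : v + v = 0.
Proof.
apply/rowP => i; rewrite !mxE.
by apply: (addrr_pchar2 (pchar_Fp (isT : prime 2))).
Qed.

Lemma mem_F2sub (m : nat) (v : F2vec m.+1) :
  (v \in F2sub m.+1) = ((v : 'rV['F_2]_m.+1) ord0 ord0 == 0).
Proof.
rewrite inE; apply/forallP/idP => [/(_ ord0) // | v0 i].
by apply/implyP => /eqP i0; rewrite (_ : i = ord0) //; apply: val_inj.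
Qed.

(** The first coordinate takes only two values, so two vectors outside the
    subspace agree there and their sum falls back into it. *)
Lemma F2sub_add (m : nat) (x y : F2vec m.+1) :
  (x + y \in F2sub m.+1) = ((x \in F2sub m.+1) == (y \in F2sub m.+1)).
Proof.
rewrite !mem_F2sub mxE.
have F2_add (a b : 'F_2) : (a + b == 0) = ((a == 0) == (b == 0)).
  by case: a => [[|[|?]] ?] //; case: b => [[|[|?]] ?].
exact: F2_add.
Qed.

Theorem theorem4p1 (n : nat) (hn : (2 <= n)%N) (A B : {set F2vec n})
    (hA : A \subset F2sub n :\ 0%R)
    (hB : B \subset [set: F2vec n] :\: F2sub n) :
  (rcount1 (A :|: B) = rcount1 A + 3 * rcount A B B)%N.
Proof.
case: n hn A B hA hB => // m _ A B hA hB.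
have sAH : A \subset F2sub m.+1 by apply: subset_trans hA (subD1set _ _).
have sBH : B \subset ~: F2sub m.+1 by rewrite -setTD.
rewrite (rcount1U_index2 _ _ _ _ (@F2sub_add m) sAH sBH).
rewrite (rcountC _ B A B) (rcount_rev _ (@addF2vv m.+1) B B A).
by rewrite !mulSn mul0n addn0 !addnA.
Qed.
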